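(* Let $f_1,f_2,f_3$ be power spectral density functions on $[-\pi,\pi)$ with $\log f_i\in L_1[-\pi,\pi)$ for $i\in\{1,2,3\}$. Then: (i) $\delta(f_1,f_2)\in\mathbb{R}_+\cup\{\infty\}$, where $\mathbb{R}_+=[0,\infty)$. (ii) $\delta(f_1,f_2)=0$ if and only if $f_1(\theta)/f_2(\theta)$ is constant (almost everywhere). (iii) For each $b\in\{2,3\}$, $\delta(f_1,f_{\tau,1,b})$ is monotonically increasing (i.e. nondecreasing) as a function of $\tau\in[0,1]$. (iv) $\delta(f_1,f_{\tau,2,3})$ is convex as a function of $\tau\in[0,1]$.
   Context: A power spectral density function is a nonnegative integrable function on $[-\pi,\pi)$; functions are identified when equal almost everywhere. For density functions $f,g$ with $\log f,\log g\in L_1[-\pi,\pi)$ define $$\delta_{a/g}(f,g):=\log\left(\frac{1}{2\pi}\int_{-\pi}^{\pi}\frac{f(\theta)}{g(\theta)}\,d\theta\right)-\frac{1}{2\pi}\int_{-\pi}^{\pi}\log\left(\frac{f(\theta)}{g(\theta)}\right)d\theta ,$$ with value $+\infty$ if $f/g$ is not integrable, and its symmetrized version $$\delta(f,g):=\delta_{a/g}(f,g)+\delta_{a/g}(g,f)=\log\left(\frac{1}{2\pi}\int_{-\pi}^{\pi}\frac{f(\theta)}{g(\theta)}\,d\theta\right)+\log\left(\frac{1}{2\pi}\int_{-\pi}^{\pi}\frac{g(\theta)}{f(\theta)}\,d\theta\right).$$ For density functions $f_a,f_b$, the logarithmic interval between them is $f_{\tau,a,b}:=f_a^{1-\tau}f_b^{\tau}$,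 $\tau\in[0,1]$. Convexity and monotonicity are understood for functions with values in $[0,\infty]$. *)

(* Defs.v *)
From mathcomp Require Import all_boot all_order all_algebra.
From mathcomp Require Import all_classical all_reals all_analysis.

Set Implicit Arguments.
Unset Strict Implicit.
Unset Printing Implicit Defensive.

Import Order.TTheory GRing.Theory Num.Theory.
Import numFieldNormedType.Exports.

Local Open Scope classical_set_scope.
Local Open Scope ring_scope.
Local Open Scope ereal_scope.

Definition freq (R : realType) : set R := `[(- pi)%R, pi%R[%classic.
Arguments freq R : clear implicits.

(* Densities are honest functions on the real line of which only the
   restriction to [freq] matters; identification almost everywhere is not
   built in, so equalities between them have to be stated with [{ae _, _}]. *)
Definition power_spectral_density (R : realType) (f : R -> R) : Prop :=
  (forall x, freq R x -> (0 <= f x)%R) /\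
  (@lebesgue_measure R).-integrable (freq R) (fun x => (f x)%:E).

(* The extended logarithm [lne], with [lne 0 = -oo], is essential: the real
   [ln] has the junk value [ln 0 = 0], so that integrability of [ln \o f] would
   not force [f] to be positive almost everywhere. *)
Definition log_integrable (R : realType) (f : R -> R) : Prop :=
  (@lebesgue_measure R).-integrable (freq R) (fun x => lne (f x)%:E).

Definition freq_mean (R : realType) (h : R -> \bar R) : \bar R :=
  ((2 * pi)^-1)%:E * \int[@lebesgue_measure R]_(x in freq R) h x.

(* Under [log_integrable g] the function [g] vanishes only on a null set, so
   that the convention [x / 0 = 0] does not affect the integrals. *)
Definition delta_ag (R : realType) (f g : R -> R) : \bar R :=
  if `[< (@lebesgue_measure R).-integrable (freq R)
           (fun x => (f x / g x)%:E) >]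
  then lne (freq_mean (fun x => (f x / g x)%:E))
       - freq_mean (fun x => lne (f x / g x)%:E)
  else +oo.

Definition delta (R : realType) (f g : R -> R) : \bar R :=
  delta_ag f g + delta_ag g f.

Definition log_interval (R : realType) (fa fb : R -> R) (tau : R) : R -> R :=
  fun x => (fa x `^ (1 - tau) * fb x `^ tau)%R.

(* For functions with values in [0, +oo]; the product of [\bar R] satisfies
   [0 * +oo = 0], so the inequality is trivial for [l = 0] and [l = 1]. *)
Definition econvex_on (R : realType) (I : interval R) (F : R -> \bar R) : Prop :=
  {in I &, forall s t : R, forall l : R, l \in `[0%R, 1%R] ->
    F ((1 - l) * s + l * t)%R <= (1 - l)%:E * F s + l%:E * F t}.

(* Main.v *)
(* Write [f_i = exp a_i] almost everywhere and let [L h] be the logarithm of the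
   mean of [exp h].  The means of the logarithms cancel in the symmetrization,
   so that [delta f g = L h + L (- h)] for [h] the difference of the logarithms
   of [f] and [g].  The functional [L] is convex: after shifting both arguments
   so that their exponentials have mean 1, this is the mean of the pointwise
   convexity of [exp].  Along a logarithmic interval [h] is affine in [tau],
   which gives (iv); (i) is convexity at the midpoint of [h] and [- h], and
   (iii) holds because a nonnegative convex function vanishing at 0 is
   nondecreasing. *)
Require Import Defs.
From mathcomp Require Import all_boot all_order all_algebra.
From mathcomp Require Import all_classical all_reals all_analysis.
From mathcomp Require Import measurable_realfun ring lra.

Import Order.TTheory GRing.Theory Num.Theory.
Import numFieldNormedType.Exports.

Local Open Scope classical_set_scope.
Local Open Scope ring_scope.
Local Open Scope ereal_scope.

(** * The frequency interval, its measure and measurability facts *)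

Lemma measurable_freq (R : realType) :
  measurable (freq R : set (measurableTypeR R)).
Proof. exact: measurable_itv. Qed.
#[local] Hint Extern 0 (measurable (freq _)) => exact: measurable_freq : core.

Lemma lebesgue_measure_freq (R : realType) :
  @lebesgue_measure R (freq R) = (2 * pi)%:E.
Proof.
have := @pi_gt0 R => pi0.
rewrite lebesgue_measure_itv/= lte_fin ifT -?EFinD ?opprK; last lra.
by congr EFin; lra.
Qed.

(** Lets [filterS] and [filterS2] combine almost-everywhere statements about the Lebesgue
    measure. *)
Instance lebesgue_ae_filter (R : realType) :
  Filter (nbhs (almost_everywhere (@lebesgue_measure R))).
Proof. exact: (@ae_filter_ringOfSetsType _ (measurableTypeR R)). Qed.

(** The interval has measure [2 * pi > 0], so a null set of exceptions cannot cover it. *)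
Lemma ae_freq_exists (R : realType) (P : R -> Prop) :
  {ae @lebesgue_measure R, forall x, freq R x -> P x} ->
  exists x, freq R x /\ P x.
Proof.
move=> [N [mN N0 PN]]; apply: contrapT => noP.
have : @lebesgue_measure R (freq R) <= lebesgue_measure N.
  apply: le_measure; rewrite ?inE//.
  move=> x Dx; apply: PN => /= Px; apply: noP.
  by exists x; split=> //; exact: Px.
rewrite [leRHS]N0 [leLHS]lebesgue_measure_freq lee_fin.
by apply/negP; rewrite -ltNge mulr_gt0// pi_gt0.
Qed.

Lemma measurable_lne_EFin (R : realType) :
  measurable_fun [set: R] (fun r : R => lne r%:E).
Proof.
apply: measurable_fun_ifT => //=; first exact: measurable_fun_ler.
by apply/measurable_EFinP.
Qed.

(** * Normalized means over the frequency interval *)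

Section freq_mean_theory.
Context {R : realType}.
Implicit Types h f g : R -> \bar R.
Notation D := (freq R).
Notation mu := (@lebesgue_measure R).

Lemma freq_mean_cst (c : R) : freq_mean (fun=> c%:E) = c%:E.
Proof.
rewrite /freq_mean integral_cst// [X in _ * (_ * X)]lebesgue_measure_freq.
by rewrite muleCA -EFinM mulVf ?mulr1// gt_eqF// mulr_gt0// pi_gt0.
Qed.

Lemma inv2pi_ge0 : (0 <= (2 * @pi R)^-1)%R.
Proof. by rewrite invr_ge0 mulr_ge0// pi_ge0. Qed.

(** Nonnegativity takes the place of integrability here and below, so that the rules also cover
    infinite means. *)
Lemma ge0_freq_meanD f g : measurable_fun D f -> measurable_fun D g ->
  (forall x, D x -> 0 <= f x) -> (forall x, D x -> 0 <= g x) ->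
  freq_mean (fun x => f x + g x) = freq_mean f + freq_mean g.
Proof.
move=> mf mg f0 g0; rewrite /freq_mean ge0_integralD// ge0_muleDr//.
all: exact: integral_ge0.
Qed.

Lemma ge0_freq_meanZ (c : R) f : (0 <= c)%R -> measurable_fun D f ->
  (forall x, D x -> 0 <= f x) ->
  freq_mean (fun x => c%:E * f x) = c%:E * freq_mean f.
Proof.
by move=> c0 mf f0; rewrite /freq_mean ge0_integralZl_EFin// muleCA.
Qed.

Lemma ge0_le_freq_mean f g : measurable_fun D f -> measurable_fun D g ->
  (forall x, D x -> 0 <= f x) -> (forall x, D x -> f x <= g x) ->
  freq_mean f <= freq_mean g.
Proof.
move=> mf mg f0 fg; apply: lee_wpmul2l; first by rewrite lee_fin inv2pi_ge0.
apply: ge0_le_integral => // x Dx; exact: le_trans (f0 x Dx) (fg x Dx).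
Qed.

Lemma freq_mean_ge0 f : (forall x, D x -> 0 <= f x) -> 0 <= freq_mean f.
Proof.
by move=> f0; rewrite mule_ge0 ?lee_fin ?inv2pi_ge0//; exact: integral_ge0.
Qed.

Lemma ge0_freq_mean_eq0 f : measurable_fun D f ->
  (forall x, D x -> 0 <= f x) -> freq_mean f = 0 ->
  {ae mu, forall x, D x -> f x = 0}.
Proof.
move=> mf f0 /eqP; rewrite mule_eq0 eqe invr_eq0 mulf_eq0 pnatr_eq0/=.
rewrite (gt_eqF (pi_gt0 R))/= => /eqP i0.
apply/(ae_eq_integral_abs mu (measurable_freq R) mf).
rewrite -i0; apply: eq_integral => x /[!inE] Dx.
by rewrite gee0_abs// f0.
Qed.

End freq_mean_theory.

(** * The logarithm of the mean of an exponential *)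

Section log_mean_exp.
Context {R : realType}.
Implicit Types a b h : R -> R.
Notation D := (freq R).
Notation mu := (@lebesgue_measure R).

Definition mean_exp h : \bar R := freq_mean (fun x => (expR (h x))%:E).

(** The functional [L] of the overview: the log-moment [log E[exp h]] under the uniform law on
    [freq R]. *)
Definition log_mean_exp h : \bar R := lne (mean_exp h).

Lemma measurable_expRE h : measurable_fun D h ->
  measurable_fun D (fun x => (expR (h x))%:E).
Proof.
by move=> mh; apply/measurable_EFinP; exact: measurableT_comp.
Qed.

(** A zero mean would force the nonnegative function [exp h] to vanish at some point, which is
    absurd. Finite values are written [expR k] so that their logarithm is simply [k]. *)
Lemma mean_exp_spec h : measurable_fun D h ->
  mean_exp h = +oo \/ exists k, mean_exp h = (expR k)%:E.
Proof.
move=> mh.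
have E0 x : D x -> 0 <= (expR (h x))%:E by rewrite lee_fin expR_ge0.
have : mean_exp h != 0.
  apply/negP => /eqP /(ge0_freq_mean_eq0 _ (measurable_expRE _ mh) E0).
  move=> /ae_freq_exists[x [_ [/eqP]]].
  by rewrite gt_eqF ?expR_gt0.
have : 0 <= mean_exp h by exact: freq_mean_ge0.
case: (mean_exp h) => [r r0 rn0|_ _|//]; last by left.
by right; exists (ln r); rewrite lnK// posrE lt_neqAle eq_sym -eqe rn0.
Qed.

Lemma log_mean_exp_spec h : measurable_fun D h ->
  log_mean_exp h = +oo \/
  exists2 k, mean_exp h = (expR k)%:E & log_mean_exp h = k%:E.
Proof.
rewrite /log_mean_exp => /mean_exp_spec[->|[k ->]]; first by left.
by right; exists k => //; rewrite lne_EFin ?expR_gt0// expRK.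
Qed.

Lemma log_mean_exp_neqNy h : measurable_fun D h -> log_mean_exp h != -oo.
Proof. by move=> /log_mean_exp_spec[->|[k _ ->]]. Qed.

Lemma mean_expD_cst h (c : R) : measurable_fun D h ->
  mean_exp (fun x => h x + c)%R = (expR c)%:E * mean_exp h.
Proof.
move=> mh; rewrite /mean_exp -ge0_freq_meanZ ?expR_ge0//.
- by under eq_fun do rewrite expRD mulrC EFinM.
- exact: measurable_expRE.
Qed.

Lemma log_mean_exp_cst (c : R) : log_mean_exp (fun=> c) = c%:E.
Proof.
by rewrite /log_mean_exp /mean_exp freq_mean_cst lne_EFin ?expR_gt0// expRK.
Qed.

Lemma expR_convex (l x y : R) : (0 <= l <= 1)%R ->
  (expR ((1 - l) * x + l * y) <= (1 - l) * expR x + l * expR y)%R.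
Proof.
move=> /andP[l0 l1].
(* The graph lies above its tangent at [z]. Averaging this bound at [x] and [y], with [z] their
   barycenter, cancels the first-order terms. *)
have tangent (z w : R) : (expR z * (1 + (w - z)) <= expR w)%R.
  rewrite -{2}(subrK z w) expRD mulrC ler_pM2r ?expR_gt0//.
  exact: expR_ge1Dx.
set z := ((1 - l) * x + l * y)%R.
have := lerD (ler_wpM2l (_ : 0 <= 1 - l)%R (tangent z x))
  (ler_wpM2l l0 (tangent z y)).
rewrite subr_ge0 => /(_ l1); apply: le_trans.
by rewrite le_eqVlt; apply/orP; left; apply/eqP; rewrite /z; ring.
Qed.

Lemma mean_exp_sub_eq1 h (k : R) : measurable_fun D h ->
  mean_exp h = (expR k)%:E -> mean_exp (fun x => h x - k)%R = 1.
Proof.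
move=> mh hk; rewrite mean_expD_cst// hk -EFinM -expRD addNr.
by rewrite expR0.
Qed.

Lemma log_mean_exp_convex a b (l : R) :
  measurable_fun D a -> measurable_fun D b -> (0 <= l <= 1)%R ->
  log_mean_exp (fun x => (1 - l) * a x + l * b x)%R <=
  (1 - l)%:E * log_mean_exp a + l%:E * log_mean_exp b.
Proof.
(* At the endpoints [0 * +oo = 0] may hide an infinite term, but there both sides coincide. For
   strictly positive weights an infinite term makes the right side [+oo], since neither term is
   [-oo]. *)
move=> ma mb /andP[]; rewrite le_eqVlt => /predU1P[<- _|l0].
  rewrite subr0 mul1e mul0e adde0.
  by under eq_fun do rewrite mul1r mul0r addr0.
rewrite le_eqVlt => /predU1P[->|l1].
  rewrite subrr mul1e mul0e add0e.
  by under eq_fun do rewrite mul1r mul0r add0r.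
have l1' : (0 < 1 - l)%R by rewrite subr_gt0.
have [Kb|[m Mb Kb]] := log_mean_exp_spec _ mb.
  rewrite Kb gt0_muley ?lte_fin// addey ?leey//.
  by have [->|[k _ ->]] := log_mean_exp_spec _ ma; rewrite ?gt0_muley ?lte_fin.
have [Ka|[k Ma Ka]] := log_mean_exp_spec _ ma.
  by rewrite Ka gt0_muley ?lte_fin// addye ?leey// Kb.
(* Both values are now finite and [q] is the right side, so the claim amounts to the mean of
   [exp (c - q)] being at most 1. *)
set c := (fun x => _); set q := ((1 - l) * k + l * m)%R.
have mc : measurable_fun D c.
  by apply: measurable_funD; apply: measurable_funM.
have mak : measurable_fun D (fun x => a x - k)%R by exact: measurable_funB.
have mbm : measurable_fun D (fun x => b x - m)%R by exact: measurable_funB.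
have mcq : measurable_fun D (fun x => c x - q)%R by exact: measurable_funB.
have cq : mean_exp (fun x => c x - q)%R <= 1.
  have -> : 1 = (1 - l)%:E * mean_exp (fun x => a x - k)%R +
                l%:E * mean_exp (fun x => b x - m)%R.
    by rewrite !mean_exp_sub_eq1// !mule1 -EFinD subrK.
  rewrite /mean_exp -!ge0_freq_meanZ ?(ltW l0) ?(ltW l1')//;
    [|exact: measurable_expRE..].
  have mZ h (r : R) : measurable_fun D h ->
      measurable_fun D (fun x => r%:E * (expR (h x))%:E).
    by move=> mh; apply: measurable_funeM; exact: measurable_expRE.
  rewrite -ge0_freq_meanD//; first last.
  - by move=> x _; rewrite mule_ge0 ?lee_fin ?expR_ge0 ?ltW.
  - by move=> x _; rewrite mule_ge0 ?lee_fin ?expR_ge0 ?ltW.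
  - exact: mZ.
  - exact: mZ.
  apply: ge0_le_freq_mean => //.
  - exact: measurable_expRE.
  - by apply: emeasurable_funD; exact: mZ.
  move=> x _; rewrite -!EFinM -EFinD lee_fin.
  apply: le_trans (expR_convex _ _ _ _); last by rewrite !ltW.
  by rewrite ler_expR /c /q le_eqVlt; apply/orP; left; apply/eqP; ring.
rewrite Ka Kb -!EFinM -EFinD -/q.
move: cq; rewrite mean_expD_cst//.
(* An infinite mean of [exp c] would remain infinite after scaling by [exp (- q)], against the bound
   by 1. *)
have [Mc|[r Mc]] := mean_exp_spec _ mc.
  by rewrite Mc gt0_muley ?lte_fin ?expR_gt0.
rewrite /log_mean_exp Mc -EFinM -expRD lne_EFin ?expR_gt0// expRK !lee_fin.
by rewrite -expR0 ler_expR; lra.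
Qed.

(** The form that [delta f g] takes for [h = log f - log g]. *)
Definition sym_log_mean_exp h : \bar R :=
  log_mean_exp h + log_mean_exp (fun x => - h x)%R.

Lemma ae_eq_log_mean_exp a b : measurable_fun D a -> measurable_fun D b ->
  {ae mu, forall x, D x -> a x = b x} -> log_mean_exp a = log_mean_exp b.
Proof.
move=> ma mb ab; rewrite /log_mean_exp /mean_exp /freq_mean.
rewrite (@ae_eq_integral _ _ _ mu D (fun x => (expR (b x))%:E))//.
- exact: measurable_expRE.
- exact: measurable_expRE.
- by move: ab; apply: filterS => x /[apply] ->.
Qed.

Lemma ae_eq_sym_log_mean_exp a b : measurable_fun D a -> measurable_fun D b ->
  {ae mu, forall x, D x -> a x = b x} ->
  sym_log_mean_exp a = sym_log_mean_exp b.
Proof.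
move=> ma mb ab; rewrite /sym_log_mean_exp (ae_eq_log_mean_exp _ _ ma mb ab).
rewrite (ae_eq_log_mean_exp _ _ (measurable_funN ma) (measurable_funN mb))//.
by move: ab; apply: filterS => x /[apply] /= ->.
Qed.

Lemma sym_log_mean_exp_cst (c : R) : sym_log_mean_exp (fun=> c) = 0.
Proof. by rewrite /sym_log_mean_exp !log_mean_exp_cst -EFinD subrr. Qed.

Lemma sym_log_mean_exp_ge0 h : measurable_fun D h -> 0 <= sym_log_mean_exp h.
Proof.
move=> mh; have mNh : measurable_fun D (fun x => - h x)%R.
  exact: measurable_funN.
have half : (0 <= (2^-1 : R) <= 1)%R by lra.
have := log_mean_exp_convex _ _ _ mh mNh half.
have -> : (fun x => (1 - 2^-1) * h x + 2^-1 * - h x)%R = (fun=> 0%R).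
  by apply/funext => x; field.
have -> : (1 - 2^-1 = 2^-1 :> R)%R by field.
rewrite log_mean_exp_cst /sym_log_mean_exp.
have [->|[k _ ->]] := log_mean_exp_spec _ mh;
  have [->|[m _ ->]] := log_mean_exp_spec _ mNh;
  rewrite ?leey//.
by rewrite -!EFinM -!EFinD !lee_fin; lra.
Qed.

Lemma sym_log_mean_exp_convex a b (l : R) :
  measurable_fun D a -> measurable_fun D b -> (0 <= l <= 1)%R ->
  sym_log_mean_exp (fun x => (1 - l) * a x + l * b x)%R <=
  (1 - l)%:E * sym_log_mean_exp a + l%:E * sym_log_mean_exp b.
Proof.
move=> ma mb l01.
have mNa : measurable_fun D (fun x => - a x)%R by exact: measurable_funN.
have mNb : measurable_fun D (fun x => - b x)%R by exact: measurable_funN.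
(* Distributivity in [\bar R] requires the sum not to be of the form [+oo - oo]; no value of
   [log_mean_exp] is [-oo]. *)
have distr (c : R) (x y : \bar R) : x != -oo -> y != -oo ->
    c%:E * (x + y) = c%:E * x + c%:E * y.
  by move=> xNy yNy; rewrite muleDr// /adde_def (negbTE xNy) (negbTE yNy) andbF.
rewrite /sym_log_mean_exp !distr ?log_mean_exp_neqNy// addeACA.
apply: leeD; first exact: log_mean_exp_convex.
have -> : (fun x => - ((1 - l) * a x + l * b x))%R =
    (fun x => (1 - l) * - a x + l * - b x)%R.
  by apply/funext => x; ring.
exact: log_mean_exp_convex.
Qed.

(* The two means are reciprocal, so [u = exp (h - k)] satisfies
   [mean u = mean (1 / u) = 1], whereas [u + 1 / u >= 2]. *)
Lemma sym_log_mean_exp_eq0 h : measurable_fun D h ->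
  sym_log_mean_exp h = 0 ->
  exists k, {ae mu, forall x, D x -> h x = k}.
Proof.
move=> mh; have mNh : measurable_fun D (fun x => - h x)%R.
  exact: measurable_funN.
rewrite /sym_log_mean_exp.
have [->|[k Mh ->]] := log_mean_exp_spec _ mh.
  by have [->|[m _ ->]] := log_mean_exp_spec _ mNh.
have [->//|[m MNh ->]] := log_mean_exp_spec _ mNh.
move=> [/eqP]; rewrite addr_eq0 => /eqP kE; exists k.
pose u x := (h x - k)%R.
have m_u : measurable_fun D u by exact: measurable_funB.
have mNu : measurable_fun D (fun x => - u x)%R by exact: measurable_funN.
have M1 : mean_exp u = 1 by exact: mean_exp_sub_eq1.
have M2 : mean_exp (fun x => - u x)%R = 1.
  rewrite -(mean_exp_sub_eq1 _ _ mNh MNh); congr mean_exp; apply/funext => x.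
  by rewrite /u kE; ring.
(* A square times a positive factor: [w] is nonnegative and vanishes only where [u] does, while its
   mean is [1 + 1 - 2 = 0]. *)
pose w x := (expR (u x) + expR (- u x) - 2)%R.
have wE x : w x = ((expR (u x) - 1) ^+ 2 * expR (- u x))%R.
  by rewrite /w expRN; field; rewrite gt_eqF// expR_gt0.
have w0 x : D x -> 0 <= (w x)%:E.
  by move=> _; rewrite lee_fin wE mulr_ge0 ?sqr_ge0 ?expR_ge0.
have mw : measurable_fun D (fun x => (w x)%:E).
  apply/measurable_EFinP; apply: measurable_funB => //.
  by apply: measurable_funD; exact: measurableT_comp.
have Mw : freq_mean (fun x => (w x)%:E) = 0.
  have : mean_exp u + mean_exp (fun x => - u x)%R =
      2%:E + freq_mean (fun x => (w x)%:E).
    rewrite -(freq_mean_cst 2) /mean_exp -!ge0_freq_meanD//.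
    - congr freq_mean; apply/funext => x; rewrite -!EFinD /w.
      by congr EFin; ring.
    - exact: measurable_expRE.
    - exact: measurable_expRE.
  rewrite M1 M2; case: (freq_mean _) => //= r [] r2; congr EFin; lra.
have := ge0_freq_mean_eq0 _ mw w0 Mw.
apply: filterS => x /[apply] -[] /eqP.
rewrite wE mulf_eq0 [X in _ || X]gt_eqF ?expR_gt0// orbF sqrf_eq0 subr_eq0.
by rewrite -[1%R]expR0 => /eqP /expR_inj /eqP; rewrite subr_eq0 => /eqP.
Qed.

End log_mean_exp.

(** * From densities to their logarithms, and the properties of [delta] *)

Section delta_exponential_form.
Context {R : realType}.
Implicit Types a b f g : R -> R.
Notation D := (freq R).
Notation mu := (@lebesgue_measure R).

(* [a] is an integrable logarithm of [f]; unlike [lne (f x)%:E] it takes finite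
   values everywhere. *)
Record has_log f a : Prop := HasLog {
  has_log_ge0 : forall x, D x -> (0 <= f x)%R;
  has_log_measurable : measurable_fun D f;
  has_log_integrable : mu.-integrable D (EFin \o a);
  has_log_expR : {ae mu, forall x, D x -> f x = expR (a x)} }.

(** An integrable [lne (f x)%:E] is finite almost everywhere, which excludes [f x = 0] there; where
    [f x > 0] it agrees with [ln (f x)]. *)
Lemma psd_has_log f : power_spectral_density f -> log_integrable f ->
  has_log f (fun x => ln (f x)).
Proof.
move=> [f0 /measurable_int/measurable_EFinP mf] lf.
have fpos : {ae mu, forall x, D x -> (0 < f x)%R}.
  have := integrable_ae (measurable_freq R) lf.
  apply: filterS => x /[apply].
  by rewrite ltNge /lne; case: ifP.
have mlnf : measurable_fun D (EFin \o (fun x => ln (f x))).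
  by apply/measurable_EFinP; apply: measurableT_comp.
split=> //; last first.
  by move: fpos; apply: filterS => x /[apply] f0x; rewrite lnK.
apply/integrableP; split => //; case/integrableP: lf => mlf.
apply: le_lt_trans; apply: ae_ge0_le_integral => //.
- exact: measurableT_comp.
- exact: measurableT_comp.
by move: fpos; apply: filterS => x /[apply] f0x; rewrite lne_EFin.
Qed.

Lemma has_log_measurable_log f a : has_log f a -> measurable_fun D a.
Proof. by case=> _ _ /measurable_int/measurable_EFinP. Qed.

Lemma measurable_ratio f g : (forall x, D x -> (0 <= g x)%R) ->
  measurable_fun D f -> measurable_fun D g ->
  measurable_fun D (fun x => f x / g x)%R.
Proof.
move=> g0 mf mg; apply: measurable_funM => //.
(* On nonnegative reals, 0 included, inversion agrees with the measurable power map of exponent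
   [-1]. *)
apply: (eq_measurable_fun (fun x => g x `^ (-1))%R).
  by move=> x /[!inE] Dx; rewrite powR_inv1// g0.
exact: (measurableT_comp (measurable_powR (-1)) mg).
Qed.

Lemma delta_ag_exp f g a b : has_log f a -> has_log g b ->
  exists r : R, freq_mean (fun x => (a x - b x)%:E) = r%:E /\
    delta_ag f g = log_mean_exp (fun x => a x - b x)%R - r%:E.
Proof.
move=> [f0 mf ia fa] [g0 mg ib gb].
have iab : mu.-integrable D (fun x => (a x - b x)%:E).
  exact: (integrableB (measurable_freq R) ia ib).
have mab : measurable_fun D (fun x => a x - b x)%R.
  by apply/measurable_EFinP; exact: (measurable_int _ iab).
have mfg : measurable_fun D (fun x => (f x / g x)%:E).
  by apply/measurable_EFinP; exact: measurable_ratio.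
have fgE : {ae mu, forall x, D x -> (f x / g x = expR (a x - b x))%R}.
  apply: filterS2 fa gb => x fx gx Dx.
  by rewrite fx// gx// expRB.
have meanE : freq_mean (fun x => (f x / g x)%:E) =
    mean_exp (fun x => a x - b x)%R.
  congr (_ * _); apply: ae_eq_integral => //; first exact: measurable_expRE.
  by move: fgE; apply: filterS => x /[apply] ->.
have meanlnE : freq_mean (fun x => lne (f x / g x)%:E) =
    freq_mean (fun x => (a x - b x)%:E).
  congr (_ * _); apply: ae_eq_integral => //.
  - apply: (measurableT_comp (measurable_lne_EFin R)).
    by apply/measurable_EFinP.
  - exact/measurable_EFinP.
  - move: fgE; apply: filterS => x /[apply] ->.
    by rewrite lne_EFin ?expR_gt0// expRK.
have /fineK : freq_mean (fun x => (a x - b x)%:E) \is a fin_num.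
  by rewrite fin_numM//; exact: integrable_fin_num.
move: (fine _) => r /esym rE.
exists r; split => //; rewrite /delta_ag meanE meanlnE rE.
(* If [f / g] is not integrable, [delta_ag] is [+oo] by definition. The right side is then [+oo]
   too: [r] is finite, and a nonnegative measurable function of finite mean would be integrable. *)
case: asboolP => // nint.
suff -> : log_mean_exp (fun x => a x - b x)%R = +oo by [].
have [//|[k Mk _]] := log_mean_exp_spec _ mab.
exfalso; apply: nint; apply/integrableP; split=> //.
rewrite (_ : \int[mu]_(x in D) _ =
    \int[mu]_(x in D) (f x / g x)%:E); last first.
  apply: eq_integral => x /[!inE] Dx; rewrite gee0_abs// lee_fin.
  by rewrite divr_ge0 ?f0 ?g0.
move: Mk; rewrite -meanE /freq_mean.
case: (\int[mu]_(x in D) _) => //; first by move=> ? _; rewrite ltry.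
by rewrite gt0_muley// lte_fin invr_gt0 mulr_gt0// pi_gt0.
Qed.

Lemma delta_exp f g a b : has_log f a -> has_log g b ->
  delta f g = sym_log_mean_exp (fun x => a x - b x)%R.
Proof.
move=> fa gb; rewrite /delta /sym_log_mean_exp.
have [r [rE ->]] := delta_ag_exp _ _ _ _ fa gb.
have [s [sE ->]] := delta_ag_exp _ _ _ _ gb fa.
have -> : (fun x => - (a x - b x))%R = (fun x => b x - a x)%R.
  by apply/funext => x; rewrite opprB.
(* The means of [a - b] and [b - a] are opposite finite numbers, so the logarithmic terms cancel in
   the symmetrization. *)
have -> : s = (- r)%R.
  apply: EFin_inj; rewrite EFinN -rE -sE /freq_mean -muleN -integralN//=.
    by congr (_ * _); apply: eq_integral => x _; rewrite opprB.
  apply: integrable_add_def => //.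
  exact: (integrableB (measurable_freq R) (has_log_integrable _ _ fa)
    (has_log_integrable _ _ gb)).
by rewrite addeACA -EFinN -EFinN -EFinD opprK addNr adde0.
Qed.

Lemma log_interval_has_log f g a b (t : R) : has_log f a -> has_log g b ->
  has_log (log_interval f g t) (fun x => (1 - t) * a x + t * b x)%R.
Proof.
move=> [f0 mf ia fa] [g0 mg ib gb]; split.
- by move=> x _; rewrite mulr_ge0 ?powR_ge0.
- apply: measurable_funM.
  + exact: (measurableT_comp (measurable_powR _) mf).
  + exact: (measurableT_comp (measurable_powR _) mg).
- exact: (integrableD (measurable_freq R)
    (integrableZl (measurable_freq R) (1 - t) ia)
    (integrableZl (measurable_freq R) t ib)).
- apply: filterS2 fa gb => x fx gx Dx.
  rewrite /log_interval fx// gx// -!expRM -expRD.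
  by rewrite [in RHS]mulrC [(t * _)%R]mulrC.
Qed.

Lemma delta_ge0 f g a b : has_log f a -> has_log g b -> 0 <= delta f g.
Proof.
move=> fa gb; rewrite (delta_exp _ _ _ _ fa gb); apply: sym_log_mean_exp_ge0.
by apply: measurable_funB; apply: has_log_measurable_log; eassumption.
Qed.

Lemma delta_eq0P f g a b : has_log f a -> has_log g b ->
  delta f g = 0 <->
  exists c : R, {ae mu, forall x, D x -> (f x / g x)%R = c}.
Proof.
move=> fa gb; rewrite (delta_exp _ _ _ _ fa gb).
have mab : measurable_fun D (fun x => a x - b x)%R.
  by apply: measurable_funB; apply: has_log_measurable_log; eassumption.
have fgE : {ae mu, forall x, D x -> (f x / g x = expR (a x - b x))%R}.
  apply: filterS2 (has_log_expR _ _ fa) (has_log_expR _ _ gb) => x fx gx Dx.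
  by rewrite fx// gx// expRB.
split=> [/(sym_log_mean_exp_eq0 _ mab)[k abk]|[c fgc]].
  exists (expR k); apply: filterS2 fgE abk => x fgx abx Dx.
  by rewrite fgx// abx.
have abc : {ae mu, forall x, D x -> (expR (a x - b x) = c)%R}.
  by apply: filterS2 fgE fgc => x fgx cx Dx; rewrite -fgx ?cx.
(* Nothing says that [c] is positive; evaluating at one good point exhibits it as an exponential,
   and injectivity of [expR] then makes [a - b] constant. *)
have [x0 [_ cE]] := ae_freq_exists _ _ abc.
have {}abc : {ae mu, forall x, D x -> (a x - b x = a x0 - b x0)%R}.
  by move: abc; apply: filterS => x /[apply]; rewrite -cE => /expR_inj.
apply: etrans (sym_log_mean_exp_cst (a x0 - b x0)).
exact: (ae_eq_sym_log_mean_exp _ _ mab (measurable_cst _) abc).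
Qed.

Lemma delta_log_interval_convex f g h a b c :
  has_log f a -> has_log g b -> has_log h c ->
  econvex_on `[0%R, 1%R] (fun t : R => delta f (log_interval g h t)).
Proof.
move=> fa gb hc s t _ _ l; rewrite in_itv/= => l01.
have E u := delta_exp _ _ _ _ fa (log_interval_has_log _ _ _ _ u gb hc).
have ma := has_log_measurable_log _ _ fa.
have mb := has_log_measurable_log _ _ gb.
have mc := has_log_measurable_log _ _ hc.
have mlin (u : R) :
    measurable_fun D (fun x => a x - ((1 - u) * b x + u * c x))%R.
  apply: measurable_funB => //.
  by apply: measurable_funD; exact: measurable_funM.
have := sym_log_mean_exp_convex _ _ _ (mlin s) (mlin t) l01.
rewrite !E; apply: le_trans.
(* The exponent [a - ((1 - u) * b + u * c)] is affine in [u], so both left sides evaluate the same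
   function. *)
rewrite le_eqVlt; apply/orP; left; apply/eqP; congr sym_log_mean_exp.
by apply/funext => x; ring.
Qed.

Lemma delta_log_interval_homo f g a b : has_log f a -> has_log g b ->
  {in `[0%R, 1%R] &, {homo (fun t : R => delta f (log_interval f g t))
    : s t / (s <= t)%R >-> s <= t}}.
Proof.
move=> fa gb s t s01 t01 st /=.
have Lt u := log_interval_has_log _ _ _ _ u fa gb.
have t0 : (0 <= t)%R by move: t01; rewrite in_itv => /andP[].
have s0 : (0 <= s)%R by move: s01; rewrite in_itv => /andP[].
have [t_eq0|t_neq0] := eqVneq t 0%R.
  by have -> : s = t by lra.
(* Convexity between 0 and [t] with weight [s / t] bounds the value at [s] by [s / t] times the
   value at [t], because the value at 0 vanishes. *)
have l01 : (0 <= s / t <= 1)%R.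
  by rewrite divr_ge0//= ler_pdivrMr ?mul1r// lt_neqAle eq_sym t_neq0.
have delta0 : delta f (log_interval f g 0) = 0.
  rewrite (delta_exp _ _ _ _ fa (Lt 0%R)).
  have -> : (fun x => a x - ((1 - 0) * a x + 0 * b x))%R = (fun=> 0%R).
    by apply/funext => x; ring.
  exact: sym_log_mean_exp_cst.
have z01 : 0%R \in `[0%R, 1%R : R] by rewrite in_itv/= lexx ler01.
have := delta_log_interval_convex _ _ _ _ _ _ fa fa gb 0%R t z01 t01 (s / t)%R.
have -> : ((1 - s / t) * 0 + s / t * t = s)%R by field.
rewrite in_itv/= l01 delta0 mule0 add0e => /(_ isT).
have := delta_ge0 _ _ _ _ fa (Lt t).
move: (delta f _) (delta f _) => x y x0 yx; apply: le_trans yx _.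
by rewrite -[leRHS]mul1e; apply: lee_wpmul2r => //; case/andP: l01.
Qed.

End delta_exponential_form.

Theorem proposition4 (R : realType) (f1 f2 f3 : R -> R)
    (psd1 : power_spectral_density f1) (log1 : log_integrable f1)
    (psd2 : power_spectral_density f2) (log2 : log_integrable f2)
    (psd3 : power_spectral_density f3) (log3 : log_integrable f3) :
  [/\ 0 <= delta f1 f2,
      delta f1 f2 = 0 <->
        exists c : R, {ae @lebesgue_measure R, forall x,
          freq R x -> (f1 x / f2 x)%R = c},
      {in `[0%R, 1%R] &, {homo (fun tau : R => delta f1 (log_interval f1 f2 tau))
          : s t / (s <= t)%R >-> s <= t}} /\
      {in `[0%R, 1%R] &, {homo (fun tau : R => delta f1 (log_interval f1 f3 tau))
          : s t / (s <= t)%R >-> s <= t}}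
    & econvex_on `[0%R, 1%R] (fun tau : R => delta f1 (log_interval f2 f3 tau))].
Proof.
have L1 := psd_has_log _ psd1 log1.
have L2 := psd_has_log _ psd2 log2.
have L3 := psd_has_log _ psd3 log3.
split.
- exact: delta_ge0 L1 L2.
- exact: delta_eq0P L1 L2.
- by split; [exact: delta_log_interval_homo L1 L2
            |exact: delta_log_interval_homo L1 L3].
- exact: delta_log_interval_convex L1 L2 L3.
Qed.
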